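(* The marginal density path $p_t(x)=\int_{\mathbb{R}^d}p_t(x\mid x_1)p_1(x_1)\,\mathrm{d}x_1$ is generated by the SDE $$\mathrm{d}X_t=\bigl(f_tX_t+g_t^2\,\nabla\log p_t(X_t)\bigr)\mathrm{d}t+g_t\,\mathrm{d}W_t,\qquad X_0\sim p_0;$$ that is, for all $t\in(0,1)$ and $x\in\mathbb{R}^d$, $$\partial_tp_t(x)=-\nabla\cdot\Bigl(\bigl[f_tx+g_t^2\nabla\log p_t(x)\bigr]p_t(x)\Bigr)+\tfrac12g_t^2\,\Delta p_t(x).$$
   Context: Generative-time convention: $X_1\sim p_1$ is a data sample in $\mathbb{R}^d$ with density $p_1$, and time $0$ corresponds to noise. Schedules: $\alpha_t,\sigma_t$ are differentiable functions on $[0,1]$ with $\alpha_0=0$, $\alpha_1=1$, $\sigma_0=1$, $\sigma_1=0$, $\alpha_t,\sigma_t\ge0$, and $\alpha_t>0$, $\sigma_t>0$ for $t\in(0,1)$; a dot denotes $\mathrm{d}/\mathrm{d}t$. Coefficients (generative-time): $f_t:=\dot\alpha_t/\alpha_t$ and $g_t^2:=-\frac{\mathrm{d}}{\mathrm{d}t}\sigma_t^2+2\frac{\dot\alpha_t}{\alpha_t}\sigma_t^2$, assumed $\ge0$, with $g_t=\sqrt{g_t^2}$. Conditional path: $p_t(x\mid x_1):=\mathcal{N}(x;\alpha_tx_1,\sigma_t^2I)$. $W_t$ is a standard $d$-dimensional Brownian motion; differential operators act on $x$. Convention: an SDE generates a density path when the path satisfies the associated Fokker--Planck equation and the law at the initial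 time is the prescribed one. *)

(* Defs.v *)
From HB Require Import structures.
From mathcomp Require Import all_boot all_order all_algebra.
From mathcomp Require Import all_classical all_reals all_analysis.

Set Implicit Arguments.
Unset Strict Implicit.
Unset Printing Implicit Defensive.

Import Order.TTheory GRing.Theory Num.Theory.
Import numFieldNormedType.Exports.

Local Open Scope classical_set_scope.
Local Open Scope ring_scope.

Definition rV_display : measure_display.
Proof. exact: default_measure_display. Qed.

(* The product sigma-algebra, i.e. the Borel sigma-algebra of R^n. *)
Section measurable_rV.
Context {R : realType} (n : nat).

Let coord (i : 'I_n) (x : 'rV[R]_n) : measurableTypeR R := x 0 i.

Let rV_set0 : g_sigma_preimage coord set0.
Proof. exact: sigma_algebra0. Qed.

Let rV_setC A : g_sigma_preimage coord A -> g_sigma_preimage coord (~` A).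
Proof. exact: sigma_algebraC. Qed.

Let rV_bigcup (F : _^nat) : (forall i, g_sigma_preimage coord (F i)) ->
  g_sigma_preimage coord (\bigcup_i (F i)).
Proof. exact: sigma_algebra_bigcup. Qed.

HB.instance Definition _ :=
  @isMeasurable.Build rV_display 'rV[R]_n
    (g_sigma_preimage coord) rV_set0 rV_setC rV_bigcup.

End measurable_rV.

Section lebesgue_rV.
Context {R : realType}.

Lemma measurable_coord_rV n (i : 'I_n) :
  measurable_fun [set: 'rV[R]_n] (fun x : 'rV[R]_n => x 0 i).
Proof.
move=> _ Y mY; rewrite setTI; apply: sub_sigma_algebra => /=.
rewrite -bigcup_seq/=; exists i => /=; first by rewrite mem_index_enum.
by exists Y => //; rewrite setTI.
Qed.

Lemma measurable_fun_rVP d (T : measurableType d) n (f : T -> 'rV[R]_n) :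
  (forall i, measurable_fun [set: T] (fun x => f x 0 i)) ->
  measurable_fun [set: T] f.
Proof.
move=> mf _ B mB; rewrite setTI.
suff : measurable `<=` [set B : set 'rV[R]_n | measurable (f @^-1` B)].
  by apply.
apply: smallest_sub.
  split => /=.
  - by rewrite preimage_set0.
  - by move=> A mA; rewrite setTD preimage_setC; exact: measurableC.
  - by move=> F mF; rewrite preimage_bigcup; exact: bigcupT_measurable.
rewrite -bigcup_seq; apply: bigcup_sub => i _ _ [A mA <-] /=.
by have := mf i measurableT A mA; rewrite !setTI.
Qed.

Definition cons_rV n (z : measurableTypeR R * 'rV[R]_n) : 'rV[R]_n.+1 :=
  row_mx (z.1)%:M z.2.

Lemma cons_rV0 n (z : measurableTypeR R * 'rV[R]_n) :
  cons_rV z 0 ord0 = z.1.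
Proof.
have := row_mxEl (z.1)%:M z.2 0 (ord0 : 'I_1).
rewrite [RHS]mxE eqxx mulr1n => <-; congr (cons_rV z _ _); exact/val_inj.
Qed.

Lemma cons_rVS n (z : measurableTypeR R * 'rV[R]_n) j :
  cons_rV z 0 (lift ord0 j) = z.2 0 j.
Proof.
rewrite -(row_mxEr (z.1)%:M z.2 0 j); congr (cons_rV z _ _); exact/val_inj.
Qed.

Lemma measurable_cons_rV n : measurable_fun setT (@cons_rV n).
Proof.
apply: measurable_fun_rVP => i.
have [j ->|->] := unliftP ord0 i.
  under eq_fun do rewrite cons_rVS.
  exact: (measurableT_comp (measurable_coord_rV j) measurable_snd).
by under eq_fun do rewrite cons_rV0; exact: measurable_fst.
Qed.

(* The image of the iterated product of the one-dimensional Lebesgue measure;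
   see [lebesgue_rV_box]. *)
Fixpoint lebesgue_rV n : set 'rV[R]_n -> \bar R :=
  match n return set 'rV[R]_n -> \bar R with
  | 0 => dirac (0 : 'rV[R]_0)
  | n'.+1 => pushforward (product_measure1 lebesgue_measure (@lebesgue_rV n'))
                         (@cons_rV n')
  end.

Lemma lebesgue_rV_sigma_finite_measure n :
  exists mu : {sigma_finite_measure set 'rV[R]_n -> \bar R},
    mu = @lebesgue_rV n :> (set 'rV[R]_n -> \bar R).
Proof.
elim: n => [|n [m mE]]; first by exists (dirac (0 : 'rV[R]_0)).
rewrite /= -mE.
pose l : {measure set (measurableTypeR R) -> \bar R} := lebesgue_measure.
have mc := @measurable_cons_rV n.
pose mu : set 'rV[R]_n.+1 -> \bar R :=
  pushforward (product_measure1 l m) (@cons_rV n).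
have mu0 : mu set0 = 0%E by rewrite /mu /pushforward preimage_set0 measure0.
have mu_ge0 A : (0 <= mu A)%E by exact: measure_ge0.
have mu_sigma : semi_sigma_additive mu.
  move=> F mF tF mUF; rewrite /mu /pushforward preimage_bigcup.
  have mpre A : measurable A -> measurable (@cons_rV n @^-1` A).
    by move=> mA; rewrite -[X in measurable X]setTI; exact: mc.
  apply: measure_semi_sigma_additive.
  - by move=> k; exact: mpre.
  - apply/trivIsetP => /= i j _ _ ij; rewrite -preimage_setI.
    by move/trivIsetP : tF => /(_ _ _ _ _ ij) ->//; rewrite preimage_set0.
  - by rewrite -preimage_bigcup; exact: mpre.
have mu_sigma_finite : sigma_finite setT mu.
  have /sigma_finiteP[F [FT ndF mF]] :=
    sigma_finiteT (lebesgue_measure : {sigma_finite_measure set (measurableTypeR R) -> \bar R}).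
  have /sigma_finiteP[G [GT ndG mG]] := sigma_finiteT m.
  pose tl (x : 'rV[R]_n.+1) : 'rV[R]_n := \row_j x 0 (lift ord0 j).
  have mtl : measurable_fun setT tl.
    apply: measurable_fun_rVP => i.
    by under eq_fun do rewrite mxE; exact: measurable_coord_rV.
  have tl_cons z : tl (cons_rV z) = z.2.
    by apply/rowP => j; rewrite mxE cons_rVS.
  exists (fun k => [set x : 'rV[R]_n.+1 | F k (x 0 ord0)] `&` tl @^-1` G k).
    apply/esym; rewrite -subTset => x _.
    have [i _ Fi] : (\bigcup_i F i) (x 0 ord0) by rewrite -FT.
    have [j _ Gj] : (\bigcup_i G i) (tl x) by rewrite -GT.
    exists (maxn i j) => //; split => /=.
    + by have /subsetPset := ndF _ _ (leq_maxl i j); apply.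
    + by have /subsetPset := ndG _ _ (leq_maxr i j); apply.
  move=> k; split.
    apply: measurableI; rewrite -[X in measurable X]setTI.
    - exact: (measurable_coord_rV ord0 measurableT (mF k).1).
    - exact: (mtl measurableT _ (mG k).1).
  rewrite /mu /pushforward.
  rewrite (_ : _ @^-1` _ = F k `*` G k); last first.
    by apply/seteqP; split => -[y z] /=; rewrite cons_rV0 tl_cons.
  rewrite product_measure1E//; [|exact: (mF k).1|exact: (mG k).1].
  by apply: lte_mul_pinfty => //; rewrite ?ge0_fin_numE//; [
    exact: (mF k).2|exact: (mG k).2].
pose H1 := isMeasure.Build _ _ _ mu mu0 mu_ge0 mu_sigma.
pose m' : {measure set 'rV[R]_n.+1 -> \bar R} := HB.pack mu H1.
pose H2 := @Measure_isSigmaFinite.Build _ _ _ m' mu_sigma_finite.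
pose m2 : {sigma_finite_measure set 'rV[R]_n.+1 -> \bar R} := HB.pack (Measure.sort m') H2.
by exists m2.
Qed.

Section instances.
Variable n : nat.
Local Notation mu := (@lebesgue_rV n).

Let mu0 : mu set0 = 0%E.
Proof. by have [m <-] := lebesgue_rV_sigma_finite_measure n. Qed.

Let mu_ge0 A : (0 <= mu A)%E.
Proof. by have [m <-] := lebesgue_rV_sigma_finite_measure n. Qed.

Let mu_sigma_additive : semi_sigma_additive mu.
Proof.
have [m <-] := lebesgue_rV_sigma_finite_measure n.
exact: measure_semi_sigma_additive.
Qed.

HB.instance Definition _ :=
  isMeasure.Build _ _ _ mu mu0 mu_ge0 mu_sigma_additive.

Let mu_sigma_finite : sigma_finite setT mu.
Proof.
by have [m <-] := lebesgue_rV_sigma_finite_measure n; exact: sigma_finiteT.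
Qed.

HB.instance Definition _ :=
  @Measure_isSigmaFinite.Build _ _ _ mu mu_sigma_finite.

End instances.

Lemma lebesgue_rV_box n (a b : 'rV[R]_n) : (forall i, a 0 i <= b 0 i) ->
  lebesgue_rV [set x : 'rV[R]_n | forall i, a 0 i <= x 0 i <= b 0 i] =
  (\prod_i (b 0 i - a 0 i))%:E.
Proof.
elim: n a b => [|n IH] a b ab.
  by rewrite big_ord0 /= diracE mem_set//=; case.
pose tl (x : 'rV[R]_n.+1) : 'rV[R]_n := \row_j x 0 (lift ord0 j).
pose B := [set x : 'rV[R]_n | forall i, tl a 0 i <= x 0 i <= tl b 0 i].
have -> : lebesgue_rV [set x : 'rV[R]_n.+1 |
      forall i, a 0 i <= x 0 i <= b 0 i] =
    product_measure1 lebesgue_measure (@lebesgue_rV n)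
      (`[a 0 ord0, b 0 ord0] `*` B).
  rewrite /= /pushforward; congr (product_measure1 _ _ _).
  apply/seteqP; split => -[y z] /= h.
    split; first by have := h ord0; rewrite cons_rV0 in_itv.
    by move=> i; have := h (lift ord0 i); rewrite cons_rVS !mxE.
  case: h => h0 h1 i; have [j ->|->] := unliftP ord0 i.
    by have := h1 j; rewrite cons_rVS !mxE.
  by move: h0; rewrite cons_rV0 in_itv.
have mB : measurable B.
  rewrite (_ : B = \bigcap_(i in [set: 'I_n])
      ((fun x : 'rV[R]_n => x 0 i) @^-1` `[tl a 0 i, tl b 0 i])); last first.
    apply/seteqP; split => x h i; last by have := h i I; rewrite /= in_itv.
    by move=> _; rewrite /= in_itv; exact: h.
  apply: fin_bigcap_measurable => // i _; rewrite -[X in measurable X]setTI.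
  exact: (measurable_coord_rV i measurableT (measurable_itv _)).
rewrite product_measure1E//= [lebesgue_rV B]IH; last first.
  by move=> i; rewrite !mxE.
rewrite big_ord_recl EFinM lebesgue_measure_itv/= lte_fin.
congr (_ * _)%E; last by under eq_bigr do rewrite !mxE.
have := ab ord0; rewrite le_eqVlt => /orP[/eqP ->|->]; last by rewrite EFinB.
by rewrite ltxx subrr.
Qed.

End lebesgue_rV.

Section operators.
Context {R : realType} {d : nat}.

Definition partial (i : 'I_d) (f : 'rV[R]_d -> R) (x : 'rV[R]_d) : R :=
  'D_(delta_mx 0 i : 'rV[R]_d) f x.

Definition partial_derivable (i : 'I_d) (f : 'rV[R]_d -> R) (x : 'rV[R]_d) :=
  derivable f x (delta_mx 0 i : 'rV[R]_d).

Definition grad (f : 'rV[R]_d -> R) (x : 'rV[R]_d) : 'rV[R]_d :=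
  \row_i partial i f x.

Definition divergence (v : 'rV[R]_d -> 'rV[R]_d) (x : 'rV[R]_d) : R :=
  \sum_i partial i (fun y => v y 0 i) x.

Definition laplacian (f : 'rV[R]_d -> R) (x : 'rV[R]_d) : R :=
  \sum_i partial i (partial i f) x.

End operators.

(* Differentiability relative to [A]; for [A = [0, 1]] it is the two-sided
   notion inside and the one-sided notion at the end points. *)
Definition derivable_within {R : realType} (A : set R) (f : R -> R) (t : R) :=
  cvg ((fun s => (s - t)^-1 * (f s - f t)) @ within A t^').

(* The equation of dX = b_t(X) dt + g_t dW on (0, 1), in the classical sense:
   ['D_v] and [derive1] are total, so the existence of every derivative that
   occurs is part of the definition. *)
Definition fokker_planck {R : realType} {d : nat}
    (b : R -> 'rV[R]_d -> 'rV[R]_d) (g : R -> R) (p : R -> 'rV[R]_d -> R) :=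
  forall (t : R) (x : 'rV[R]_d), 0 < t < 1 ->
  [/\ derivable (fun s => p s x) t 1,
      forall i, partial_derivable i (fun y => p t y * b t y 0 i) x,
      forall i, partial_derivable i (p t) x,
      forall i, partial_derivable i (partial i (p t)) x
    & derive1 (fun s => p s x) t =
      - divergence (fun y => p t y *: b t y) x
      + 2^-1 * g t ^+ 2 * laplacian (p t) x].

(* [p0] is the density of the law prescribed at time 0. *)
Definition sde_generates {R : realType} {d : nat}
    (b : R -> 'rV[R]_d -> 'rV[R]_d) (g : R -> R) (p0 : 'rV[R]_d -> R)
    (p : R -> 'rV[R]_d -> R) :=
  p 0 = p0 /\ fokker_planck b g p.

(* Meaningful for [S] positive definite only. *)
Definition gaussian_pdf {R : realType} {d : nat}
    (m : 'rV[R]_d) (S : 'M[R]_d) (x : 'rV[R]_d) : R :=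
  (Num.sqrt ((2 * pi) ^+ d * \det S))^-1 *
  expR (- 2^-1 * ((x - m) *m invmx S *m (x - m)^T) 0 0).

Definition probability_density {R : realType} {d : nat} (p : 'rV[R]_d -> R) :=
  [/\ measurable_fun setT p, forall x, 0 <= p x &
      (\int[@lebesgue_rV R d]_x (p x)%:E = 1)%E].

Section gaussian_path.
Context {R : realType} {d : nat}.
Variables (alpha sigma : R -> R) (p1 : 'rV[R]_d -> R).

Definition conditional_path (t : R) (x x1 : 'rV[R]_d) : R :=
  gaussian_pdf (alpha t *: x1) (sigma t ^+ 2)%:M x.

Definition marginal_path (t : R) (x : 'rV[R]_d) : R :=
  (\int[@lebesgue_rV R d]_x1 (conditional_path t x x1 * p1 x1))%R.

Definition drift_coef (t : R) : R := derive1 alpha t / alpha t.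

Definition diffusion_coef2 (t : R) : R :=
  - derive1 (fun s => sigma s ^+ 2) t
  + 2 * (derive1 alpha t / alpha t) * sigma t ^+ 2.

Definition diffusion_coef (t : R) : R := Num.sqrt (diffusion_coef2 t).

End gaussian_path.

(* Main.v *)
(* As a function of the data point z, the conditional density is the exponential
   of a quadratic polynomial whose coefficients depend on (t, x). A perturbation
   of size r of these coefficients changes the exponent by u = O(r (1 + |z|^2)),
   and |e^u - 1 - u| <= u^2 (1 + e^u), so the Gaussian decay in z bounds the
   first order Taylor remainder by C r^2 uniformly in z. Hence one can
   differentiate under the integral against any density p_1, without moment
   assumptions and without continuity of the derivatives of alpha and sigma.
   All the derivatives in the Fokker-Planck equation then become combinations of
   the integrals of 1, z_i and z_i^2 against the conditional density times p_1,
   and the equation holds separately for each coordinate i. *)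
Require Import Defs.
From HB Require Import structures.
From mathcomp Require Import all_boot all_order all_algebra.
From mathcomp Require Import all_classical all_reals all_analysis.
From mathcomp Require Import measurable_realfun ring lra.
Import Order.TTheory GRing.Theory Num.Theory.
Import numFieldNormedType.Exports.
Local Open Scope classical_set_scope.
Local Open Scope ring_scope.

(** * Elementary bounds for the exponential *)

Lemma expR_taylor1 (R : realType) (u : R) :
  `|expR u - 1 - u| <= u ^+ 2 * (1 + expR u).
Proof.
have e1 := expR_ge1Dx u.
have e2 : expR u * (1 - u) <= 1.
  have := expR_ge1Dx (- u).
  by rewrite -(ler_pM2l (expR_gt0 u)) expRN mulfV// gt_eqF// expR_gt0.
have e0 := expR_gt0 u.
rewrite ger0_norm; last by lra.
(* By [e2], e^u - 1 - u <= u (e^u - 1). For u >= 0, [e2] bounds e^u - 1 by u e^u; for u < 0, [e1]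
   bounds 1 - e^u by -u. *)
have [u0|u0] := leP 0 u; nra.
Qed.

(** This is [expR_taylor1] at u = b - a, scaled by e^a; the error involves only the two end values
    of the exponential. *)
Lemma expR_sub_taylor1 (R : realType) (a b : R) :
  `|expR b - expR a - (b - a) * expR a| <= (b - a) ^+ 2 * (expR a + expR b).
Proof.
have -> : expR b = expR a * expR (b - a) by rewrite -expRD; congr expR; ring.
have -> : expR a * expR (b - a) - expR a - (b - a) * expR a =
  expR a * (expR (b - a) - 1 - (b - a)) by ring.
rewrite normrM (ger0_norm (expR_ge0 _)).
have -> : (b - a) ^+ 2 * (expR a + expR a * expR (b - a)) =
  expR a * ((b - a) ^+ 2 * (1 + expR (b - a))) by ring.
by rewrite ler_pM2l ?expR_gt0// expR_taylor1.
Qed.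

(** With m = [n.+1], the inequality e^(ey/m) >= ey/m, raised to the power m, gives e^(ey) >=
    (ey/m)^m. *)
Lemma exprMexpRN_bounded (R : realType) (n : nat) (e y : R) : 0 < e -> 0 <= y ->
  y ^+ n.+1 * expR (- (e * y)) <= (n.+1%:R / e) ^+ n.+1.
Proof.
move=> e0 y0.
rewrite expRN ler_pdivrMr ?expR_gt0//.
have -> : expR (e * y) = expR (e * y / n.+1%:R) ^+ n.+1.
  by rewrite -expRM_natl [n.+1%:R * _]mulrC divfK// pnatr_eq0.
rewrite -exprMn; apply: lerXn2r; rewrite ?nnegrE//.
  by rewrite mulr_ge0// ?expR_ge0// divr_ge0// ltW.
rewrite -ler_pdivrMl ?divr_gt0// invf_div.
rewrite mulrAC; apply: le_trans (expR_ge1Dx _).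
by rewrite lerDr.
Qed.

(** * Exponentials of quadratic polynomials, uniformly in the coefficients *)

Section gaussian_exponent.
Context {R : realType} {d : nat}.
Implicit Types (a c : R) (b : 'I_d -> R) (z : 'rV[R]_d).

(** The coefficient [c] is common to all coordinates because the covariance is isotropic; [a] will
    absorb the normalising factor. *)
Definition gauss_exponent a b c z : R :=
  a + \sum_(i < d) (b i * z 0 i - c * z 0 i ^+ 2).

(** This one weight dominates 1, |z_i| and z_i^2, the monomials that a change of the coefficients
    produces. *)
Definition sqr_weight z : R := 1 + \sum_(i < d) z 0 i ^+ 2.

Lemma sqr_weight_ge1 z : 1 <= sqr_weight z.
Proof. by rewrite lerDl sumr_ge0// => i _; exact: sqr_ge0. Qed.

Lemma sqr_coord_le_weight z i : z 0 i ^+ 2 <= sqr_weight z.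
Proof.
rewrite /sqr_weight (bigD1 i)//= addrCA lerDl addr_ge0// sumr_ge0// => j _.
exact: sqr_ge0.
Qed.

Lemma coord_le_weight z i : `|z 0 i| <= sqr_weight z.
Proof.
have [z1|z1] := leP `|z 0 i| 1; first exact: le_trans (sqr_weight_ge1 z).
apply: le_trans (sqr_coord_le_weight z i).
by rewrite -real_normK ?num_real// expr2 ler_pMr// ?ltW// (lt_trans ltr01).
Qed.

Lemma sqr_weight_le_cube z : sqr_weight z <= sqr_weight z ^+ 3.
Proof. by rewrite -[leLHS]expr1 ler_weXn2l// sqr_weight_ge1. Qed.

Lemma weightM_le_cube (u v : R) z : `|u| <= sqr_weight z ->
  `|v| <= sqr_weight z -> `|u * v| <= sqr_weight z ^+ 3.
Proof.
move=> uW vW; rewrite normrM (@le_trans _ _ (sqr_weight z ^+ 2))//.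
  by rewrite expr2 ler_pM.
by rewrite ler_weXn2l// sqr_weight_ge1.
Qed.

(** Completing the square, L |z_i| <= L^2/(2k) + (k/2) z_i^2, so half of the decay -k z_i^2 absorbs
    the linear term; the summand k/2 offsets the 1 in [sqr_weight]. *)
Lemma gauss_exponent_le (k L a c : R) b z : 0 < k -> a <= L ->
  (forall i, `|b i| <= L) -> k <= c ->
  gauss_exponent a b c z <=
    L + d%:R * (L ^+ 2 / (2 * k)) + k / 2 - k / 2 * sqr_weight z.
Proof.
move=> k0 aL bL kc.
have Lsum : \sum_(i < d) (b i * z 0 i - c * z 0 i ^+ 2) <=
    \sum_(i < d) (L ^+ 2 / (2 * k) - k / 2 * z 0 i ^+ 2).
  apply: ler_sum => i _.
  have h1 : b i * z 0 i <= L * `|z 0 i|.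
    rewrite (le_trans (ler_norm _))// normrM ler_wpM2r//.
  have h2 : k * z 0 i ^+ 2 <= c * z 0 i ^+ 2 by rewrite ler_wpM2r// sqr_ge0.
  have h3 : L * `|z 0 i| <= L ^+ 2 / (2 * k) + k / 2 * z 0 i ^+ 2.
    rewrite -[z 0 i ^+ 2]real_normK ?num_real//.
    have -> : L ^+ 2 / (2 * k) = (2 * k)^-1 * L ^+ 2 by rewrite mulrC.
    have : 0 <= (2 * k)^-1 * (L - k * `|z 0 i|) ^+ 2.
      by rewrite mulr_ge0 ?sqr_ge0// invr_ge0 mulr_ge0// ltW.
    have -> : (2 * k)^-1 * (L - k * `|z 0 i|) ^+ 2 =
       (2 * k)^-1 * L ^+ 2 + k / 2 * `|z 0 i| ^+ 2 - L * `|z 0 i|.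
      by field; rewrite gt_eqF.
    lra.
  lra.
rewrite /gauss_exponent /sqr_weight.
move: Lsum; rewrite [leRHS]sumrB sumr_const card_ord -[_ *+ d]mulr_natl.
rewrite -mulr_sumr.
lra.
Qed.

(** The cube is what the Taylor remainder costs: two powers for the squared change of the exponent,
    one for a prefactor bounded by the weight. *)
Lemma weightMgauss_bounded (k L : R) : 0 < k ->
  exists2 C : R, 0 <= C & forall a b c z, a <= L -> (forall i, `|b i| <= L) ->
    k <= c -> sqr_weight z ^+ 3 * expR (gauss_exponent a b c z) <= C.
Proof.
move=> k0.
exists ((3%:R / (k / 2)) ^+ 3 * expR (L + d%:R * (L ^+ 2 / (2 * k)) + k / 2)).
  by rewrite mulr_ge0 ?expR_ge0// exprn_ge0// divr_ge0// divr_ge0// ltW.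
move=> a b c z aL bL kc.
have w0 : 0 <= sqr_weight z by exact: le_trans (sqr_weight_ge1 z).
apply: (@le_trans _ _ (sqr_weight z ^+ 3 * (expR (- (k / 2 * sqr_weight z)) *
    expR (L + d%:R * (L ^+ 2 / (2 * k)) + k / 2)))).
  rewrite ler_wpM2l ?exprn_ge0// -expRD ler_expR [leRHS]addrC.
  exact: gauss_exponent_le.
by rewrite mulrA ler_wpM2r ?expR_ge0// exprMexpRN_bounded// divr_gt0.
Qed.

Lemma gauss_exponentB_le (r : R) a b c a' b' c' z : 0 <= r ->
  `|a' - a| <= r -> (forall i, `|b' i - b i| <= r) -> `|c' - c| <= r ->
  `|gauss_exponent a' b' c' z - gauss_exponent a b c z| <=
    r * (d%:R + 2) * sqr_weight z.
Proof.
move=> r0 ha hb hc.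
have -> : gauss_exponent a' b' c' z - gauss_exponent a b c z = (a' - a) +
    \sum_(i < d) ((b' i - b i) * z 0 i - (c' - c) * z 0 i ^+ 2).
  rewrite /gauss_exponent opprD addrACA; congr (_ + _).
  by rewrite -sumrB; apply: eq_bigr => i _; ring.
rewrite (le_trans (ler_normD _ _))//.
have : `|\sum_(i < d) ((b' i - b i) * z 0 i - (c' - c) * z 0 i ^+ 2)| <=
    \sum_(i < d) (r + (2 * r) * z 0 i ^+ 2).
  rewrite (le_trans (ler_norm_sum _ _ _))// ler_sum// => i _.
  rewrite (le_trans (ler_normB _ _))// normrM [X in _ + X]normrM.
  have h1 : `|b' i - b i| * `|z 0 i| <= r * `|z 0 i| by rewrite ler_wpM2r.
  have h2 : `|c' - c| * `|z 0 i ^+ 2| <= r * z 0 i ^+ 2.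
    by rewrite (ger0_norm (sqr_ge0 _)) ler_wpM2r// sqr_ge0.
  have h3 : r * `|z 0 i| <= r * (1 + z 0 i ^+ 2).
    rewrite ler_wpM2l// -real_normK ?num_real//.
    by have := sqr_ge0 (`|z 0 i| - 1); have := sqr_ge0 `|z 0 i|; lra.
  lra.
rewrite [leRHS]big_split/= sumr_const card_ord -[_ *+ d]mulr_natl -mulr_sumr.
rewrite /sqr_weight; set s := \sum_(i < d) z 0 i ^+ 2 => h.
have s0 : 0 <= s by apply: sumr_ge0 => i _; exact: sqr_ge0.
have : 0 <= r * s by rewrite mulr_ge0.
have : 0 <= d%:R * (r * s) by rewrite !mulr_ge0.
lra.
Qed.

(** With W the weight, the remainder is at most (r (d + 2) W)^2 (e^q + e^q'), and W^3 e^q, W^3 e^q'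
    are bounded. The factor W in the conclusion leaves room for a prefactor. *)
Lemma gauss_exponent_taylor1 a b c : 0 < c ->
  exists C delta : R, 0 < delta /\ forall (r : R) a' b' c', 0 <= r <= delta ->
    `|a' - a| <= r -> (forall i, `|b' i - b i| <= r) -> `|c' - c| <= r ->
  forall z, sqr_weight z * `|expR (gauss_exponent a' b' c' z) -
      expR (gauss_exponent a b c z) -
      (gauss_exponent a' b' c' z - gauss_exponent a b c z) *
      expR (gauss_exponent a b c z)| <= C * r ^+ 2.
Proof.
move=> c0; have k0 : 0 < c / 2 by rewrite divr_gt0.
(* The 1 in [L] and the lower bound c/2 leave room for the perturbed coefficients, so one constant
   [C] serves both exponents. *)
pose L := 1 + `|a| + \sum_(i < d) `|b i|.
have bL i : `|b i| + 1 <= L.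
  rewrite /L (bigD1 i)//=.
  have : 0 <= \sum_(j < d | j != i) `|b j| by exact: sumr_ge0.
  by have := normr_ge0 a; lra.
have aL : a + 1 <= L.
  rewrite /L; have : 0 <= \sum_(j < d) `|b j| by exact: sumr_ge0.
  by have := ler_norm a; lra.
have [C C0 hC] := weightMgauss_bounded (c / 2) L k0.
exists ((d%:R + 2) ^+ 2 * (2 * C)), (Num.min 1 (c / 2)); split.
  by rewrite lt_min ltr01.
move=> r a' b' c' /andP[r0]; rewrite le_min => /andP[r1 rc] ha hb hc z.
have w0 : 0 <= sqr_weight z by exact: le_trans (sqr_weight_ge1 z).
have e1 : sqr_weight z ^+ 3 * expR (gauss_exponent a b c z) <= C.
  apply: hC; [lra| |lra].
  by move=> i; have := bL i; lra.
have e2 : sqr_weight z ^+ 3 * expR (gauss_exponent a' b' c' z) <= C.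
  apply: hC.
  - by move: ha; rewrite ler_norml => /andP[]; lra.
  - move=> i; apply: le_trans (bL i).
    rewrite -[b' i](subrK (b i)) (le_trans (ler_normD _ _))// addrC lerD2l.
    exact: le_trans (hb i) _.
  - by move: hc; rewrite ler_norml => /andP[]; lra.
have := gauss_exponentB_le r a b c a' b' c' z r0 ha hb hc.
have := expR_sub_taylor1 _ (gauss_exponent a b c z) (gauss_exponent a' b' c' z).
set q := gauss_exponent a b c z in e1 *.
set q' := gauss_exponent a' b' c' z in e2 *.
move=> t1 t2.
have t3 : (q' - q) ^+ 2 <= (r * (d%:R + 2) * sqr_weight z) ^+ 2.
  by rewrite -[leLHS]real_normK ?num_real// lerXn2r ?nnegrE// !mulr_ge0// addr_ge0.
apply: (@le_trans _ _ (sqr_weight z *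
    ((r * (d%:R + 2) * sqr_weight z) ^+ 2 * (expR q + expR q')))).
  rewrite ler_wpM2l// (le_trans t1)// ler_wpM2r// addr_ge0// expR_ge0//.
have -> : sqr_weight z *
    ((r * (d%:R + 2) * sqr_weight z) ^+ 2 * (expR q + expR q')) =
  (d%:R + 2) ^+ 2 * r ^+ 2 *
    (sqr_weight z ^+ 3 * expR q + sqr_weight z ^+ 3 * expR q') by ring.
have -> : (d%:R + 2) ^+ 2 * (2 * C) * r ^+ 2 =
  (d%:R + 2) ^+ 2 * r ^+ 2 * (C + C) by ring.
by rewrite ler_wpM2l ?mulr_ge0 ?sqr_ge0// lerD.
Qed.

End gaussian_exponent.

(** * Directional derivatives and first order approximation *)

Section directional_derivative.
Context {R : realType} {V : normedModType R}.
Implicit Types (f : V -> R) (x v : V).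

Lemma is_derive_quadratic_remainder f x v (C : R) :
  (\forall h \near (0 : R), `|f (h *: v + x) - f x| <= C * h ^+ 2) ->
  is_derive x v f 0.
Proof.
move=> fC.
have cf : h^-1 *: (f (h *: v + x) - f x) @[h --> (0 : R)^'] --> (0 : R).
  apply/cvgr0Pnorm_le => e e0.
  near=> h.
  have h0 : 0 < `|h| by rewrite normr_gt0; near: h; exact: nbhs_dnbhs_neq.
  rewrite normrZ normfV ler_pdivrMl//.
  apply: (@le_trans _ _ (C * h ^+ 2)).
    by near: h; exact: nbhs_dnbhs fC.
  rewrite -real_normK ?num_real// expr2 mulrCA ler_pM2l//.
  apply: (@le_trans _ _ ((`|C| + 1) * `|h|)).
    by rewrite ler_wpM2r// (le_trans (ler_norm _))// lerDl.
  rewrite mulrC -ler_pdivlMr ?ltr_wpDl//.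
  near: h; apply: dnbhs0_le; rewrite divr_gt0// ltr_wpDl//.
by apply: DeriveDef; [apply/cvg_ex; exists 0|exact: cvg_lim].
Unshelve. all: by end_near. Qed.

(** The function [f] is a remainder with derivative 0, plus [g], plus a constant. This passes the
    derivative of an explicit first order part [g] on to [f]. *)
Lemma is_derive_taylor1 (f g : V -> R) x v (dg C : R) :
  g x = 0 -> is_derive x v g dg ->
  (\forall h \near (0 : R),
    `|f (h *: v + x) - f x - g (h *: v + x)| <= C * h ^+ 2) ->
  is_derive x v f dg.
Proof.
move=> g0 dgx fC.
have drem : is_derive x v (fun y => f y - f x - g y) 0.
  apply: (is_derive_quadratic_remainder _ _ _ C).
  by apply: filterS fC => h; rewrite subrr g0 !subr0.
have -> : f = (fun y => f y - f x - g y) + g + cst (f x).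
  by apply/funext => y; rewrite !fctE !subrK.
by apply: is_derive_eq; rewrite addr0 add0r.
Qed.

(** Near 0 the difference quotient is within 1 of its limit; hence plain differentiability of the
    coefficients makes their increments O(h). *)
Lemma is_derive_near_lipschitz f x v (df : R) : is_derive x v f df ->
  \forall h \near (0 : R), `|f (h *: v + x) - f x| <= (`|df| + 1) * `|h|.
Proof.
move=> [/cvg_ex[l fl] fdf].
have ldf : l = df by rewrite -fdf; apply/esym/cvg_lim.
move/cvgrPdist_le : fl => /(_ _ ltr01).
rewrite near_withinE => fl; near=> h.
have [->|h0] := eqVneq h 0.
  by rewrite scale0r add0r subrr normr0 mulr0.
have : `|l - h^-1 *: (f (h *: v + x) - f x)| <= 1.
  by move: h0; near: h.
have h0' : 0 < `|h| by rewrite normr_gt0.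
rewrite -ler_pdivrMr// [_ / _]mulrC -normfV -normrM ldf => fl1.
rewrite -[_^-1 * _](subKr df) (le_trans (ler_normB _ _))// lerD2l//.
Unshelve. all: by end_near. Qed.

Lemma is_derive_coord n (i : 'I_n) (x v : 'rV[R]_n) :
  is_derive x v (fun y : 'rV[R]_n => y 0 i) (v 0 i).
Proof.
have cf : h^-1 *: ((h *: v + x) 0 i - x 0 i) @[h --> (0 : R)^'] --> v 0 i.
  apply: (@cvg_trans _ (v 0 i @[h --> (0 : R)^'])); last exact: cvg_cst.
  apply: near_eq_cvg; near=> h; rewrite !mxE addrK /GRing.scale/= mulKf//.
  by near: h; exact: nbhs_dnbhs_neq.
by apply: DeriveDef; [apply/cvg_ex; exists (v 0 i)|exact: cvg_lim].
Unshelve. all: by end_near. Qed.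

End directional_derivative.

(** Small increments from an interior point stay in [a, b], so the limit within the interval is the
    ordinary one. *)
Lemma derivable_within_itv (R : realType) (a b : R) (f : R -> R) (t : R) :
  a < t < b -> derivable_within `[a, b] f t -> derivable f t 1.
Proof.
move=> /andP[a_t t_b] /cvg_ex[l fl]; apply/cvg_ex; exists l => /=.
apply/cvgrPdist_le => e e0.
move/cvgrPdist_le : fl => /(_ _ e0) /nbhs_ballP[r /= r0 fr].
near=> h.
have h0 : h != 0 by near: h; exact: nbhs_dnbhs_neq.
have hr : `|h| < r by near: h; exact: dnbhs0_lt.
have ha : `|h| < t - a by near: h; apply: dnbhs0_lt; rewrite subr_gt0.
have hb : `|h| < b - t by near: h; apply: dnbhs0_lt; rewrite subr_gt0.
have := fr (h + t); rewrite addrK [h *: 1]mulr1; apply.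
- by rewrite /ball/= opprD addrCA subrr addr0 normrN.
- by rewrite -subr_eq0 addrK.
- rewrite /= in_itv/=; move: ha hb; rewrite !ltr_norml => /andP[] ? ? /andP[] ? ?.
  by apply/andP; split; lra.
Unshelve. all: by end_near. Qed.

Lemma Rintegral_sum (disp : measure_display) (T : measurableType disp)
    (R : realType) (mu : {measure set T -> \bar R}) (D : set T) (n : nat)
    (f : 'I_n -> T -> R) :
  measurable D -> (forall i, mu.-integrable D (EFin \o f i)) ->
  \int[mu]_(z in D) (\sum_(i < n) f i z) =
  \sum_(i < n) \int[mu]_(z in D) f i z.
Proof.
move=> mD fi; rewrite /Rintegral.
under eq_integral do rewrite -sumEFin.
rewrite integral_sum// sum_fine// => i _.
by apply: integrable_fin_num => //; exact: fi.
Qed.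

(** * Differentiation under the integral sign *)

Section gaussian_integral.
Context {R : realType} {d : nat} (mu : {measure set 'rV[R]_d -> \bar R}).
Variable rho : 'rV[R]_d -> R.
Hypothesis rho_ge0 : forall z, 0 <= rho z.
Hypothesis rho_int : mu.-integrable setT (EFin \o rho).
Implicit Types (M : 'rV[R]_d -> R) (a c : R) (b : 'I_d -> R) (z : 'rV[R]_d).

(** The factor [M] is a parameter because derivatives multiply the integrand by z_i or z_i^2, and
    second spatial derivatives restart from M = z_i. *)
Definition gauss_integral M a b c : R :=
  \int[mu]_z (M z * expR (gauss_exponent a b c z) * rho z).

Let measurable_rho : measurable_fun setT rho.
Proof. by apply/measurable_EFinP; case/integrableP: rho_int. Qed.

Lemma measurable_gauss_exponent a b c :
  measurable_fun setT (gauss_exponent a b c).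
Proof.
apply: measurable_funD; first exact: measurable_cst.
apply: measurable_sum => i; apply: measurable_funB; apply: measurable_funM.
- exact: measurable_cst.
- exact: measurable_coord_rV.
- exact: measurable_cst.
- by apply: measurable_funX; exact: measurable_coord_rV.
Qed.

Lemma integrable_bounded_density (C : R) (f : 'rV[R]_d -> R) :
  measurable_fun setT f -> (forall z, `|f z| <= C) ->
  mu.-integrable setT (EFin \o (fun z => f z * rho z)).
Proof.
move=> mf fC; have := integrableZl measurableT C rho_int.
apply: le_integrable => //.
  by apply/measurable_EFinP; apply: measurable_funM.
by move=> z _ /=; rewrite lee_fin !normrM ler_wpM2r// (le_trans (fC z))// ler_norm.
Qed.

(** The Gaussian decay makes [M] times the exponential bounded, so integrability of [rho] is
    enough. *)
Lemma integrable_gauss M a b c : 0 < c -> measurable_fun setT M ->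
  (forall z, `|M z| <= sqr_weight z ^+ 3) ->
  mu.-integrable setT (EFin \o (fun z => M z * expR (gauss_exponent a b c z) * rho z)).
Proof.
move=> c0 mM MW.
have [C C0 hC] :=
  weightMgauss_bounded (d := d) c (`|a| + \sum_(i < d) `|b i|) c0.
apply: (integrable_bounded_density C).
  apply: measurable_funM => //; apply: measurableT_comp => //.
  exact: measurable_gauss_exponent.
move=> z; rewrite normrM (ger0_norm (expR_ge0 _)).
apply: (@le_trans _ _ (sqr_weight z ^+ 3 * expR (gauss_exponent a b c z))).
  by rewrite ler_wpM2r// expR_ge0.
apply: hC => //.
  by rewrite (le_trans (ler_norm a))// lerDl sumr_ge0.
move=> i; rewrite (bigD1 i)//= addrCA lerDl addr_ge0//.
exact: sumr_ge0.
Qed.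

Let measurable_coordX i n : measurable_fun setT (fun z : 'rV[R]_d => z 0 i ^+ n).
Proof. by apply: measurable_funX; exact: measurable_coord_rV. Qed.

Let norm_sqr_coord z i : `|z 0 i ^+ 2| <= sqr_weight z.
Proof. by rewrite ger0_norm ?sqr_ge0// sqr_coord_le_weight. Qed.

(** Serves to split the integrated first order term, where u, v, w are increments of the
    coefficients, into moments. *)
Lemma gauss_integral_linear M a b c (u w : R) (v : 'I_d -> R) : 0 < c ->
  measurable_fun setT M -> (forall z, `|M z| <= sqr_weight z) ->
  \int[mu]_z (M z * (gauss_exponent u v w z) *
     expR (gauss_exponent a b c z) * rho z) =
  u * gauss_integral M a b c +
  \sum_(i < d) (v i * gauss_integral (fun z => M z * z 0 i) a b c -
                w * gauss_integral (fun z => M z * z 0 i ^+ 2) a b c).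
Proof.
move=> c0 mM MW.
have i0 : mu.-integrable setT
    (EFin \o (fun z => M z * expR (gauss_exponent a b c z) * rho z)).
  apply: integrable_gauss => // z.
  exact: le_trans (MW z) (sqr_weight_le_cube z).
have i1 i : mu.-integrable setT
    (EFin \o (fun z => M z * z 0 i * expR (gauss_exponent a b c z) * rho z)).
  apply: integrable_gauss => //.
    by apply: measurable_funM => //; exact: measurable_coord_rV.
  by move=> z; apply: weightM_le_cube => //; exact: coord_le_weight.
have i2 i : mu.-integrable setT
    (EFin \o (fun z => M z * z 0 i ^+ 2 * expR (gauss_exponent a b c z) * rho z)).
  apply: integrable_gauss => //.
    by apply: measurable_funM => //.
  by move=> z; apply: weightM_le_cube.
have iZ (k : R) f : mu.-integrable setT (EFin \o f) ->
    mu.-integrable setT (EFin \o (fun z => k * f z)).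
  move=> fi; have := integrableZl measurableT k fi.
  by apply: eq_integrable => // z _ /=; rewrite EFinM.
rewrite (eq_Rintegral mu (g := fun z => u * (M z * expR (gauss_exponent a b c z) * rho z) +
  \sum_(i < d) (v i * (M z * z 0 i * expR (gauss_exponent a b c z) * rho z) -
    w * (M z * z 0 i ^+ 2 * expR (gauss_exponent a b c z) * rho z)))); last first.
  move=> z _; rewrite [in LHS]/gauss_exponent.
  rewrite mulrDr !mulrDl; congr (_ + _); first by ring.
  rewrite mulr_sumr !mulr_suml; apply: eq_bigr => i _.
  by set e := expR _; ring.
have iB i : mu.-integrable setT (EFin \o (fun z =>
    v i * (M z * z 0 i * expR (gauss_exponent a b c z) * rho z) -
    w * (M z * z 0 i ^+ 2 * expR (gauss_exponent a b c z) * rho z))).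
  have := integrableB measurableT (iZ (v i) _ (i1 i)) (iZ w _ (i2 i)).
  by apply: eq_integrable.
rewrite RintegralD//; [|exact: iZ|]; last first.
  have := integrable_sum measurableT (index_enum 'I_d) (fun i (_ : xpredT i) => iB i).
  by apply: eq_integrable => // z _ /=; rewrite sumEFin.
rewrite RintegralZl// Rintegral_sum//; congr (_ + _); apply: eq_bigr => i _.
by rewrite RintegralB//; [rewrite !RintegralZl|exact: iZ|exact: iZ].
Qed.

Section derivative.
Context {V : normedModType R}.
Variables (x v : V) (M : 'rV[R]_d -> R).
Variables (a c : V -> R) (b : 'I_d -> V -> R) (da dc : R) (db : 'I_d -> R).
Hypothesis measurable_M : measurable_fun setT M.
Hypothesis M_le : forall z, `|M z| <= sqr_weight z.
Hypothesis c_gt0 : 0 < c x.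
Hypothesis a_derive : is_derive x v a da.
Hypothesis b_derive : forall i, is_derive x v (b i) (db i).
Hypothesis c_derive : is_derive x v c dc.

Let q (y : V) := gauss_exponent (a y) (b ^~ y) (c y).

Let I0 (N : 'rV[R]_d -> R) := gauss_integral N (a x) (b ^~ x) (c x).

(** First order part of [F]: the integral of M (q y - q x) e^(q x) [rho], expanded into moments
    frozen at x. *)
Let lin (y : V) : R := (a y - a x) * I0 M +
  \sum_(i < d) ((b i y - b i x) * I0 (fun z => M z * z 0 i) -
                (c y - c x) * I0 (fun z => M z * z 0 i ^+ 2)).

Let F (y : V) := gauss_integral M (a y) (b ^~ y) (c y).

(** The bound of [gauss_exponent_taylor1] with r = K |h| is uniform in z; integrated against [rho]
    it gives a multiple of h^2. *)
Let F_taylor : exists C, \forall h \near (0 : R),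
  `|F (h *: v + x) - F x - lin (h *: v + x)| <= C * h ^+ 2.
Proof.
have [C [delta [d0 hC]]] := gauss_exponent_taylor1 (a x) (b ^~ x) (c x) c_gt0.
(* [K] is at least each constant of [is_derive_near_lipschitz], so the radius K |h| serves all
   coefficients. *)
pose K := 1 + `|da| + \sum_(i < d) `|db i| + `|dc|.
have s0 : 0 <= \sum_(i < d) `|db i| by exact: sumr_ge0.
have Ka : `|da| + 1 <= K by rewrite /K; have := normr_ge0 dc; lra.
have Kc : `|dc| + 1 <= K by rewrite /K; have := normr_ge0 da; lra.
have Kb i : `|db i| + 1 <= K.
  have : `|db i| <= \sum_(i < d) `|db i|.
    by rewrite (bigD1 i)//= lerDl sumr_ge0.
  by rewrite /K; have := normr_ge0 da; have := normr_ge0 dc; lra.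
have K0 : 0 < K by rewrite (lt_le_trans _ Ka)// ltr_wpDl.
exists (C * K ^+ 2 * \int[mu]_z rho z).
have nb : \forall h \near (0 : R), forall i,
    `|b i (h *: v + x) - b i x| <= K * `|h|.
  apply: (@filter_forall _ _
    (fun i h => `|b i (h *: v + x) - b i x| <= K * `|h|) _
    (nbhs_filter (0 : R))) => i.
  apply: filterS (is_derive_near_lipschitz _ _ _ _ (b_derive i)) => h hb.
  by rewrite (le_trans hb)// ler_wpM2r.
near=> h.
have hb : forall i, `|b i (h *: v + x) - b i x| <= K * `|h| by near: h.
have ha : `|a (h *: v + x) - a x| <= K * `|h|.
  apply: (@le_trans _ _ ((`|da| + 1) * `|h|)); last by rewrite ler_wpM2r.
  by near: h; exact: is_derive_near_lipschitz.
have hc : `|c (h *: v + x) - c x| <= K * `|h|.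
  apply: (@le_trans _ _ ((`|dc| + 1) * `|h|)); last by rewrite ler_wpM2r.
  by near: h; exact: is_derive_near_lipschitz.
have hdelta : 0 <= K * `|h| <= delta.
  rewrite mulr_ge0 ?(ltW K0)//= -ler_pdivlMl//.
  near: h; apply: (@nbhs0_le R R); rewrite mulr_gt0// invr_gt0//.
(* Integrability at the moved point rests on a positive quadratic coefficient there. *)
have c0 : 0 < c (h *: v + x).
  have : K * `|h| <= c x / 2.
    rewrite -ler_pdivlMl//; near: h; apply: (@nbhs0_le R R).
    by rewrite mulr_gt0 ?invr_gt0// divr_gt0.
  move: c_gt0 hc; rewrite ler_norml => cx0 /andP[h1 _] h2. lra.
have {}hC := hC (K * `|h|) _ _ _ hdelta ha hb hc.
move: (h *: v + x) c0 hC {ha hb hc} => y c0 hC.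
have MW z : `|M z| <= sqr_weight z ^+ 3.
  exact: le_trans (M_le z) (sqr_weight_le_cube z).
have iy := integrable_gauss M (a y) (b ^~ y) (c y) c0 measurable_M MW.
have ix := integrable_gauss M (a x) (b ^~ x) (c x) c_gt0 measurable_M MW.
have mq u (w : 'I_d -> R) t := measurable_gauss_exponent u w t.
pose rem z := M z * (expR (q y z) - expR (q x z) - (q y z - q x z) * expR (q x z)).
have mrem : measurable_fun setT rem.
  apply: measurable_funM => //; apply: measurable_funB.
    by apply: measurable_funB; apply: measurableT_comp => //; exact: mq.
  apply: measurable_funM; first by apply: measurable_funB; exact: mq.
  by apply: measurableT_comp => //; exact: mq.
have rem_le z : `|rem z| <= C * K ^+ 2 * h ^+ 2.
  rewrite normrM -mulrA -exprMn.
  have -> : (K * h) ^+ 2 = (K * `|h|) ^+ 2 by rewrite !exprMn real_normK ?num_real.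
  by rewrite (le_trans _ (hC z))// ler_wpM2r.
have irem := integrable_bounded_density _ _ mrem rem_le.
have -> : F y - F x - lin y = \int[mu]_z (rem z * rho z).
  rewrite /lin /I0 -gauss_integral_linear//.
  set g := gauss_exponent (a y - a x) _ _.
  have gE z : g z = q y z - q x z.
    rewrite /g /q /gauss_exponent opprD addrACA; congr (_ + _).
    by rewrite -sumrB; apply: eq_bigr => i _; ring.
  apply/eqP; rewrite subr_eq; apply/eqP.
  (* The first order term is the difference of the two full integrands minus the remainder, hence
     integrable. *)
  have ig : mu.-integrable setT (EFin \o (fun z =>
      M z * g z * expR (gauss_exponent (a x) (b^~ x) (c x) z) * rho z)).
    have := integrableB measurableT (integrableB measurableT iy ix) irem.
    apply: eq_integrable => // z _ /=.
    rewrite -!EFinB; congr (_%:E); rewrite /rem gE -/(q x z) -/(q y z).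
    by set e1 := expR _; set e2 := expR _; ring.
  rewrite -RintegralD// -RintegralB//.
  apply: eq_Rintegral => z _; rewrite /rem gE -/(q x z) -/(q y z).
  by set e1 := expR _; set e2 := expR _; ring.
rewrite (le_trans (le_normr_Rintegral _ irem))//.
have -> : C * K ^+ 2 * \int[mu]_z rho z * h ^+ 2 =
    \int[mu]_z (C * K ^+ 2 * h ^+ 2 * rho z).
  by rewrite RintegralZl//; ring.
apply: le_Rintegral => //.
- have := integrable_norm irem.
  by apply: eq_integrable.
- have := integrableZl measurableT (C * K ^+ 2 * h ^+ 2) rho_int.
  by apply: eq_integrable.
- by move=> z _; rewrite normrM (ger0_norm (rho_ge0 z)) ler_wpM2r.
Unshelve. all: by end_near. Qed.

(** [lin] vanishes at x and is a fixed linear combination of increments of the coefficients, so the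
    usual rules differentiate it; [F_taylor] passes the result on to [F]. *)
Lemma is_derive_gauss_integral : is_derive x v F
  (da * I0 M + \sum_(i < d) (db i * I0 (fun z => M z * z 0 i) -
                             dc * I0 (fun z => M z * z 0 i ^+ 2))).
Proof.
have [C FC] := F_taylor.
have lin0 : lin x = 0.
  rewrite /lin subrr mul0r add0r big1// => i _.
  by rewrite !subrr !mul0r subrr.
have dlin : is_derive x v lin
  (da * I0 M + \sum_(i < d) (db i * I0 (fun z => M z * z 0 i) -
                             dc * I0 (fun z => M z * z 0 i ^+ 2))).
  have -> : lin = (I0 M *: (a - cst (a x))) +
     \sum_(i < d) (I0 (fun z => M z * z 0 i) *: (b i - cst (b i x)) -
                   I0 (fun z => M z * z 0 i ^+ 2) *: (c - cst (c x))).
    apply/funext => y; rewrite /lin fctE; congr (_ + _).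
      by rewrite mulrC.
    rewrite fct_sumE; apply: eq_bigr => i _.
    by rewrite [in RHS]fctE; congr (_ - _); rewrite mulrC.
  apply: is_derive_eq.
  rewrite subr0 mulrC; congr (_ + _); apply: eq_bigr => i _.
  by rewrite !subr0 /GRing.scale/=; congr (_ - _); rewrite mulrC.
exact: is_derive_taylor1 lin0 dlin FC.
Qed.

End derivative.
End gaussian_integral.

(** * Moments of the Gaussian path and their derivatives *)

Section gaussian_path_integral.
Context {R : realType} {d : nat}.
Implicit Types (x y z : 'rV[R]_d) (al s : R).

(* With these coefficients [gauss_exponent] is the logarithm of the Gaussian
   density N(x; al z, s^2 I), expanded as a quadratic polynomial in z. *)
Definition path_a s x : R :=
  \sum_(i < d) (- (2^-1 * (s ^+ 2)^-1) * x 0 i ^+ 2 - 2^-1 * ln (2 * pi * s ^+ 2)).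

Definition path_b al s x (i : 'I_d) : R := al * (s ^+ 2)^-1 * x 0 i.

Definition path_c al s : R := 2^-1 * al ^+ 2 * (s ^+ 2)^-1.

(** The normalising factor enters the exponent as -ln(2 pi s^2)/2 for each coordinate, so the whole
    exponent is one sum over coordinates. *)
Lemma gaussian_pdf_scalar s (m x : 'rV[R]_d) : 0 < s ->
  gaussian_pdf m (s ^+ 2)%:M x = expR (\sum_(i < d)
    (- (2^-1 * (s ^+ 2)^-1) * (x 0 i - m 0 i) ^+ 2
     - 2^-1 * ln (2 * pi * s ^+ 2))).
Proof.
move=> s0; have s2 : 0 < s ^+ 2 by rewrite exprn_gt0.
have K0 : 0 < 2 * pi * s ^+ 2 :> R by rewrite !mulr_gt0// pi_gt0.
rewrite /gaussian_pdf det_scalar invmx_scalar -exprMn mul_mx_scalar.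
rewrite -scalemxAl !mxE sumrB sumr_const card_ord expRD mulrC; congr (_ * _).
  congr expR; rewrite mulrA mulr_sumr; apply: eq_bigr => i _.
  by rewrite !mxE; ring.
rewrite expRN; congr (_^-1).
have -> : (2 * pi * s ^+ 2) ^+ d =
    expR ((2^-1 * ln (2 * pi * s ^+ 2)) *+ d) ^+ 2.
  rewrite -expRM_natl -[_ *+ d]mulr_natl.
  have -> (u : R) : 2 * (d%:R * (2^-1 * u)) = d%:R * u by field.
  by rewrite expRM_natl lnK.
by rewrite sqrtr_sqr ger0_norm// expR_ge0.
Qed.

Lemma conditional_pathE (alpha sigma : R -> R) t x z : 0 < sigma t ->
  conditional_path alpha sigma t x z = expR (gauss_exponent
    (path_a (sigma t) x) (path_b (alpha t) (sigma t) x)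
    (path_c (alpha t) (sigma t)) z).
Proof.
move=> s0; rewrite /conditional_path gaussian_pdf_scalar//; congr expR.
rewrite /gauss_exponent /path_a -big_split/=; apply: eq_bigr => i _.
by rewrite /path_b /path_c !mxE; field; rewrite gt_eqF.
Qed.

Variable mu : {measure set 'rV[R]_d -> \bar R}.
Variable rho : 'rV[R]_d -> R.
Hypothesis rho_ge0 : forall z, 0 <= rho z.
Hypothesis rho_int : mu.-integrable setT (EFin \o rho).

Definition path_integral (M : 'rV[R]_d -> R) al s x : R :=
  gauss_integral mu rho M (path_a s x) (path_b al s x) (path_c al s).

Lemma path_c_gt0 al s : 0 < al -> 0 < s -> 0 < path_c al s.
Proof. by move=> al0 s0; rewrite /path_c !mulr_gt0// ?exprn_gt0// invr_gt0 exprn_gt0. Qed.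

(** If the integral were 0, its nonnegative integrand would vanish almost everywhere; the
    exponential is positive, so [rho] would too, and its integral would be 0. *)
Lemma path_integral_gt0 al s x : 0 < al -> 0 < s -> \int[mu]_z rho z != 0 ->
  0 < path_integral (fun=> 1) al s x.
Proof.
move=> al0 s0 rho0.
have c0 := path_c_gt0 _ _ al0 s0.
have ig : mu.-integrable setT (EFin \o (fun z => 1 *
    expR (gauss_exponent (path_a s x) (path_b al s x) (path_c al s) z) * rho z)).
  apply: integrable_gauss => // z.
  by rewrite normr1 exprn_ege1// sqr_weight_ge1.
rewrite lt_neqAle Rintegral_ge0 ?andbT; last first.
  by move=> z _; rewrite !mulr_ge0// expR_ge0.
apply: contra rho0 => /eqP int0.
have mrho : measurable_fun setT rho.
  by apply/measurable_EFinP; case/integrableP: rho_int.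
have [mg _] := integrableP _ _ _ ig.
pose g z := 1 *
  expR (gauss_exponent (path_a s x) (path_b al s x) (path_c al s) z) * rho z.
have {}int0 : (\int[mu]_z `|(EFin \o g) z| = 0)%E.
  rewrite -[RHS]/(0%:E) int0 /path_integral /gauss_integral /Rintegral.
  rewrite fineK; last exact: integrable_fin_num.
  apply: eq_integral => z _ /=; rewrite ger0_norm//.
  by rewrite /g !mulr_ge0// expR_ge0.
move/(ae_eq_integral_abs mu measurableT mg) : int0 => ae0.
rewrite /Rintegral (ae_eq_integral (cst 0%E))//.
- by rewrite integral0.
- by apply/measurable_EFinP.
- apply: filterS ae0 => z /(_ I) /= [] /eqP.
  by rewrite mul1r mulf_eq0 gt_eqF ?expR_gt0//= => /eqP ->.
Qed.

Section spatial_derivative.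
Variables (al s : R) (M : 'rV[R]_d -> R).
Hypotheses (al_gt0 : 0 < al) (s_gt0 : 0 < s).
Hypothesis measurable_M : measurable_fun setT M.
Hypothesis M_le : forall z, `|M z| <= sqr_weight z.

(** Along e_j, [path_a] changes at rate -x_j/s^2, only the j-th [path_b] changes, at rate al/s^2,
    and [path_c] is fixed. *)
Lemma is_derive_path_integral_space x (j : 'I_d) :
  is_derive x (delta_mx 0 j : 'rV[R]_d) (path_integral M al s)
    ((s ^+ 2)^-1 * (al * path_integral (fun z => M z * z 0 j) al s x -
                    x 0 j * path_integral M al s x)).
Proof.
have dcoord i := is_derive_coord _ i x (delta_mx 0 j : 'rV[R]_d).
have da : is_derive x (delta_mx 0 j : 'rV[R]_d) (path_a s)
    (- ((s ^+ 2)^-1 * x 0 j)).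
  have -> : path_a s = \sum_(i < d)
      ((- (2^-1 * (s ^+ 2)^-1)) *: ((fun y : 'rV[R]_d => y 0 i) ^+ 2) -
       cst (2^-1 * ln (2 * pi * s ^+ 2))).
    by apply/funext => y; rewrite fct_sumE.
  apply: is_derive_eq.
  rewrite (bigD1 j)//= big1 ?addr0.
    by rewrite subr0 mxE !eqxx /GRing.scale/= expr1; field; rewrite gt_eqF.
  move=> i ij; rewrite mxE eqxx (negbTE ij)/=.
  by rewrite subr0 !scaler0.
have db i : is_derive x (delta_mx 0 j : 'rV[R]_d) (fun y => path_b al s y i)
    (al * (s ^+ 2)^-1 * (i == j)%:R).
  have -> : (fun y => path_b al s y i) =
      (al * (s ^+ 2)^-1) *: (fun y : 'rV[R]_d => y 0 i) by [].
  by apply: is_derive_eq; rewrite mxE eqxx.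
have dc : is_derive x (delta_mx 0 j : 'rV[R]_d) (fun=> path_c al s) 0.
  exact: is_derive_cst.
have := @is_derive_gauss_integral _ _ mu rho rho_ge0 rho_int _ x _ M
  (path_a s) (fun=> path_c al s) (fun i y => path_b al s y i) _ _ _
  measurable_M M_le (path_c_gt0 _ _ al_gt0 s_gt0) da db dc.
move=> h; apply: (@is_derive_eq _ _ _ _ _ _ _ _ h).
rewrite (bigD1 j)//= big1 ?addr0; last first.
  by move=> i ij; rewrite (negbTE ij) mulr0 !mul0r subr0.
by rewrite eqxx mulr1 mul0r subr0 -!/(path_integral _ _ _ _); ring.
Qed.

End spatial_derivative.

(** The factors of the three moments are, up to sign, the time derivatives of [path_a] (per
    coordinate), [path_b] and [path_c]; the term -ds/sigma comes from the normalising factor. *)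
Lemma is_derive_path_integral_time (alpha sigma : R -> R) (t da ds : R) x :
  0 < alpha t -> 0 < sigma t -> is_derive t 1 alpha da -> is_derive t 1 sigma ds ->
  is_derive t 1 (fun u => path_integral (fun=> 1) (alpha u) (sigma u) x)
   (\sum_(i < d)
      ((x 0 i ^+ 2 * ds / sigma t ^+ 3 - ds / sigma t) *
         path_integral (fun=> 1) (alpha t) (sigma t) x +
       x 0 i * (da / sigma t ^+ 2 - 2 * alpha t * ds / sigma t ^+ 3) *
         path_integral (fun z => z 0 i) (alpha t) (sigma t) x -
       (alpha t * da / sigma t ^+ 2 - alpha t ^+ 2 * ds / sigma t ^+ 3) *
         path_integral (fun z => z 0 i ^+ 2) (alpha t) (sigma t) x)).
Proof.
move=> al0 s0 dal dsi.
have dV : is_derive t 1 (fun u => (sigma u ^+ 2)^-1) (- 2 * ds / sigma t ^+ 3).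
  have d2 : is_derive t 1 (fun u => sigma u ^+ 2) (2 * sigma t * ds).
    have -> : (fun u => sigma u ^+ 2) = sigma ^+ 2 by [].
    by apply: is_derive_eq; rewrite expr1.
  have := is_deriveV _ d2; rewrite sqrf_eq0 gt_eqF// => /(_ isT) h.
  apply: (@is_derive_eq _ _ _ _ _ _ _ _ h).
  by rewrite /GRing.scale/=; field; rewrite gt_eqF.
have dln : is_derive t 1 (fun u => ln (2 * pi * sigma u ^+ 2)) (2 * ds / sigma t).
  have K0 : 0 < 2 * pi * sigma t ^+ 2 by rewrite !mulr_gt0// ?pi_gt0// exprn_gt0.
  have d2 : is_derive t 1 (fun u => 2 * pi * sigma u ^+ 2)
      (2 * pi * (2 * sigma t * ds)).
    have -> : (fun u => 2 * pi * sigma u ^+ 2) = (2 * pi) *: (sigma ^+ 2) by [].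
    by apply: is_derive_eq; rewrite expr1.
  have h : is_derive t 1 (@ln R \o (fun u => 2 * pi * sigma u ^+ 2))
      ((2 * pi * sigma t ^+ 2)^-1 * (2 * pi * (2 * sigma t * ds))).
    by apply: is_derive1_comp; exact: is_derive1_ln.
  apply: (@is_derive_eq _ _ _ _ _ _ _ _ h).
  by have := pi_gt0 R; move: pi => c c0; field; rewrite !gt_eqF.
have dpa : is_derive t 1 (fun u => path_a (sigma u) x)
    (\sum_(i < d) (x 0 i ^+ 2 * ds / sigma t ^+ 3 - ds / sigma t)).
  have -> : (fun u => path_a (sigma u) x) = \sum_(i < d)
      ((- 2^-1 * x 0 i ^+ 2) *: (fun u => (sigma u ^+ 2)^-1) -
       2^-1 *: (fun u => ln (2 * pi * sigma u ^+ 2))).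
    apply/funext => u; rewrite fct_sumE; apply: eq_bigr => i _.
    by rewrite !fctE /GRing.scale/=; ring.
  apply: is_derive_eq; apply: eq_bigr => i _.
  by rewrite /GRing.scale/=; field; rewrite gt_eqF.
have dpb i : is_derive t 1 (fun u => path_b (alpha u) (sigma u) x i)
    (x 0 i * (da / sigma t ^+ 2 - 2 * alpha t * ds / sigma t ^+ 3)).
  have -> : (fun u => path_b (alpha u) (sigma u) x i) =
      x 0 i *: (alpha * (fun u => (sigma u ^+ 2)^-1)).
    by apply/funext => u; rewrite /path_b !fctE /GRing.scale/= mulrC.
  by apply: is_derive_eq; rewrite /GRing.scale/=; field; rewrite gt_eqF.
have dpc : is_derive t 1 (fun u => path_c (alpha u) (sigma u))
    (alpha t * da / sigma t ^+ 2 - alpha t ^+ 2 * ds / sigma t ^+ 3).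
  have -> : (fun u => path_c (alpha u) (sigma u)) =
      2^-1 *: (alpha ^+ 2 * (fun u => (sigma u ^+ 2)^-1)).
    by apply/funext => u; rewrite /path_c !fctE /GRing.scale/=; ring.
  apply: is_derive_eq; rewrite !fctE /GRing.scale/= expr1.
  by field; rewrite gt_eqF.
have m1 : measurable_fun setT (fun _ : 'rV[R]_d => 1 : R) by exact: measurable_cst.
have M1 (z : 'rV[R]_d) : `|1 : R| <= sqr_weight z by rewrite normr1 sqr_weight_ge1.
have := @is_derive_gauss_integral _ _ mu rho rho_ge0 rho_int _ t 1 (fun=> 1)
  (fun u => path_a (sigma u) x) (fun u => path_c (alpha u) (sigma u))
  (fun i u => path_b (alpha u) (sigma u) x i) _ _ _
  m1 M1 (path_c_gt0 _ _ al0 s0) dpa dpb dpc.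
move=> h; apply: (@is_derive_eq _ _ _ _ _ _ _ _ h).
rewrite mulr_suml -big_split/=; apply: eq_bigr => i _.
under [fun z : 'rV[R]_d => 1 * z 0 i]eq_fun do rewrite mul1r.
under [fun z : 'rV[R]_d => 1 * z 0 i ^+ 2]eq_fun do rewrite mul1r.
by rewrite addrA.
Qed.

End gaussian_path_integral.

(** * Directional derivative of a logarithm *)

Lemma is_derive_lineP (R : realType) (V : normedModType R) (f : V -> R)
    (x v : V) (df : R) :
  is_derive x v f df <-> is_derive (0 : R) 1 (fun h => f (h *: v + x)) df.
Proof.
have E : (fun h : R => h^-1 *:
      (((fun k => f (k *: v + x)) \o shift 0) (h *: 1) - f (0 *: v + x))) =
    (fun h => h^-1 *: ((f \o shift x) (h *: v) - f x)).
  by apply/funext => h; rewrite /= addr0 scale0r add0r [h *: 1]mulr1.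
split=> -[d1 d2]; apply: DeriveDef.
- by rewrite /derivable E.
- by rewrite /derive E.
- by move: d1; rewrite /derivable E.
- by move: d2; rewrite /derive E.
Qed.

(** Restricted to the line through x in direction v, this is the one-variable chain rule. *)
Lemma is_derive_ln_comp (R : realType) (V : normedModType R) (f : V -> R)
    (x v : V) (df : R) : 0 < f x -> is_derive x v f df ->
  is_derive x v (fun y => ln (f y)) (df / f x).
Proof.
move=> f0 /is_derive_lineP dfx; apply/is_derive_lineP.
have fx : f (0 *: v + x) = f x by rewrite scale0r add0r.
rewrite mulrC -fx.
apply: (@is_derive1_comp _ (@ln R) (fun h : R => f (h *: v + x))).
by apply: is_derive1_ln; rewrite fx.
Qed.

(** * The Fokker-Planck equation of the marginal path *)

Theorem proposition8p5 (R : realType) (d : nat) (alpha sigma : R -> R)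
    (p1 : 'rV[R]_d -> R)
    (alpha_diff : forall t : R, 0 <= t <= 1 -> derivable_within `[0, 1] alpha t)
    (sigma_diff : forall t : R, 0 <= t <= 1 -> derivable_within `[0, 1] sigma t)
    (alpha0 : alpha 0 = 0) (alpha1 : alpha 1 = 1)
    (sigma0 : sigma 0 = 1) (sigma1 : sigma 1 = 0)
    (alpha_ge0 : forall t : R, 0 <= t <= 1 -> 0 <= alpha t)
    (sigma_ge0 : forall t : R, 0 <= t <= 1 -> 0 <= sigma t)
    (alpha_gt0 : forall t : R, 0 < t < 1 -> 0 < alpha t)
    (sigma_gt0 : forall t : R, 0 < t < 1 -> 0 < sigma t)
    (g2_ge0 : forall t : R, 0 < t < 1 -> 0 <= diffusion_coef2 alpha sigma t)
    (p1_density : probability_density p1) :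
  let p := marginal_path alpha sigma p1 in
  let f := drift_coef alpha in
  let g := diffusion_coef alpha sigma in
  (forall (t : R) (x : 'rV[R]_d), 0 < t < 1 -> 0 < p t x) /\
  sde_generates
    (fun (t : R) (x : 'rV[R]_d) => f t *: x + g t ^+ 2 *: grad (fun y => ln (p t y)) x)
    g (p 0) p.
Proof.
move=> p f g.
have [mp1 p1_ge0 p1_int] := p1_density.
have ip1 : (@lebesgue_rV R d).-integrable setT (EFin \o p1).
  apply/integrableP; split; first exact/measurable_EFinP.
  rewrite (eq_integral (fun z => (p1 z)%:E)); first by rewrite p1_int ltry.
  by move=> z _ /=; rewrite ger0_norm.
(* Everything below is expressed by the moments [J]; the link with [p] uses sigma t > 0, hence
   interior times. *)
pose J M t x := path_integral (@lebesgue_rV R d) p1 M (alpha t) (sigma t) x.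
have pE t x : 0 < t < 1 -> p t x = J (fun=> 1) t x.
  move=> t01; apply: eq_Rintegral => z _.
  by rewrite conditional_pathE ?mul1r// sigma_gt0.
have p_gt0 t x : 0 < t < 1 -> 0 < p t x.
  move=> t01; rewrite pE//; apply: path_integral_gt0 => //.
  - exact: alpha_gt0.
  - exact: sigma_gt0.
  - by rewrite /Rintegral p1_int oner_neq0.
split=> //; split=> // t x t01.
have al0 := alpha_gt0 t t01; have s0 := sigma_gt0 t t01.
have t01' : 0 <= t <= 1 by case/andP: t01 => ? ?; rewrite !ltW.
set al := alpha t in al0; set s := sigma t in s0.
pose da := derive1 alpha t; pose ds := derive1 sigma t.
have dal : is_derive t 1 alpha da.
  apply: DeriveDef; last by rewrite /da derive1E.
  exact: derivable_within_itv (alpha_diff t t01').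
have dsi : is_derive t 1 sigma ds.
  apply: DeriveDef; last by rewrite /ds derive1E.
  exact: derivable_within_itv (sigma_diff t t01').
have pJ : p t = J (fun=> 1) t by apply/funext => y; exact: pE.
pose e (j : 'I_d) : 'rV[R]_d := delta_mx 0 j.
have dJ (M : 'rV[R]_d -> R) y j : measurable_fun setT M -> (forall z, `|M z| <= sqr_weight z) ->
    is_derive y (e j) (J M t)
      ((s ^+ 2)^-1 * (al * J (fun z => M z * z 0 j) t y - y 0 j * J M t y)).
  by move=> mM MW; apply: is_derive_path_integral_space.
have dp y j : is_derive y (e j) (p t)
    ((s ^+ 2)^-1 * (al * J (fun z => z 0 j) t y - y 0 j * p t y)).
  rewrite pJ; have := dJ (fun=> 1) y j (measurable_cst _).
  under [fun z : 'rV[R]_d => 1 * z 0 j]eq_fun do rewrite mul1r.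
  by apply=> z; rewrite normr1 sqr_weight_ge1.
(* The formula holds at every y, so it is an equality of functions and can be differentiated
   again. *)
have partialE j : partial j (p t) =
    fun y => (s ^+ 2)^-1 * (al * J (fun z => z 0 j) t y - y 0 j * p t y).
  by apply/funext => y; have [_ <-] := dp y j.
pose D1 j := (s ^+ 2)^-1 * (al * J (fun z => z 0 j) t x - x 0 j * p t x).
pose D2 j := (s ^+ 2)^-1 * (al * ((s ^+ 2)^-1 *
    (al * J (fun z => z 0 j ^+ 2) t x - x 0 j * J (fun z => z 0 j) t x)) -
  (p t x + x 0 j * D1 j)).
have dpp j : is_derive x (e j) (partial j (p t)) (D2 j).
  rewrite partialE.
  have h1 : is_derive x (e j) (J (fun z => z 0 j) t) ((s ^+ 2)^-1 *
      (al * J (fun z => z 0 j ^+ 2) t x - x 0 j * J (fun z => z 0 j) t x)).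
    exact: dJ (measurable_coord_rV j) (fun z => coord_le_weight z j).
  have h2 := is_derive_coord _ j x (e j).
  have h3 := dp x j.
  have -> : (fun y =>
        (s ^+ 2)^-1 * (al * J (fun z => z 0 j) t y - y 0 j * p t y)) =
      (s ^+ 2)^-1 *: (al *: J (fun z => z 0 j) t -
                      (fun y : 'rV[R]_d => y 0 j) * p t) by [].
  apply: is_derive_eq; rewrite /D2 /D1 /e mxE !eqxx /GRing.scale/= mulr1.
  by rewrite [p t x + _]addrC.
have dflux j : is_derive x (e j)
    (fun y => p t y * (f t *: y + g t ^+ 2 *: grad (fun y => ln (p t y)) y) 0 j)
    (f t * (p t x + x 0 j * D1 j) + g t ^+ 2 * D2 j).
  (* As p grad(log p) = grad p, the flux is f y_j p + g^2 partial_j p; the logarithm disappears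
     before differentiation. *)
  have -> : (fun y => p t y *
        (f t *: y + g t ^+ 2 *: grad (fun y => ln (p t y)) y) 0 j) =
      f t *: ((fun y : 'rV[R]_d => y 0 j) * p t) + g t ^+ 2 *: partial j (p t).
    apply/funext => y; rewrite !mxE !fctE.
    have [_ h] := is_derive_ln_comp _ _ _ _ _ _ (p_gt0 t y t01) (dp y j).
    rewrite {1}/partial h partialE /GRing.scale/=.
    by field; rewrite !gt_eqF// p_gt0.
  have h2 := is_derive_coord _ j x (e j).
  have h := is_deriveD (is_deriveZ (f t) (is_deriveM h2 (dp x j)))
    (is_deriveZ (g t ^+ 2) (dpp j)).
  apply: (@is_derive_eq _ _ _ _ _ _ _ _ h).
  rewrite /e mxE !eqxx; congr (f t * _ + _).
  by rewrite addrC; congr (_ + _); exact: mulr1.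
have dpt := is_derive_path_integral_time _ _ p1_ge0 ip1 alpha sigma t da ds x
  al0 s0 dal dsi.
(* The equality with [p] is known on (0, 1), a neighbourhood of t, which suffices to transfer the
   time derivative. *)
have nearE : \near t, path_integral (@lebesgue_rV R d) p1 (fun=> 1)
    (alpha t) (sigma t) x = p t x.
  near=> u; rewrite pE//; apply/andP; split; near: u.
    by apply: lt_nbhsr; case/andP: t01.
  by apply: lt_nbhsl; case/andP: t01.
have {}dpt := near_eq_is_derive nearE dpt.
split.
- by case: dpt.
- by move=> i; case: (dflux i).
- by move=> i; case: (dp x i).
- by move=> i; case: (dpp i).
have -> : divergence (fun y =>
      p t y *: (f t *: y + g t ^+ 2 *: grad (fun y => ln (p t y)) y)) x =
    \sum_(j < d) (f t * (p t x + x 0 j * D1 j) + g t ^+ 2 * D2 j).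
  apply: eq_bigr => j _; have [_ <-] := dflux j; congr (derive _ x _).
  by apply/funext => y; rewrite mxE.
have -> : laplacian (p t) x = \sum_(j < d) D2 j.
  by apply: eq_bigr => j _; have [_ <-] := dpp j.
rewrite derive1E; have [_ ->] := dpt.
(* By [g2_ge0] the square cancels the square root in [diffusion_coef]. *)
have g2 : g t ^+ 2 = - (2 * s * ds) + 2 * (da / al) * s ^+ 2.
  rewrite sqr_sqrtr ?g2_ge0// /diffusion_coef2 derive1E.
  congr (- _ + _).
  have -> : (fun u => sigma u ^+ 2) = sigma ^+ 2 by [].
  have [_ ->] := is_deriveX 2 dsi.
  by rewrite expr1.
(* Coordinate by coordinate there remains a rational identity in al, s, da, ds, x_j and the moments
   of 1, z_j, z_j^2. *)
rewrite g2 mulr_sumr -sumrN -big_split/=; apply: eq_bigr => j _.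
rewrite /D2 /D1 pJ /f /drift_coef -/da -/al -/s -!/(J _ t x).
by field; rewrite !gt_eqF.
Unshelve. all: by end_near. Qed.
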